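(* There is no finite complete axiomatization for functional dependencies, unary marginal identities and unary marginal distribution equivalences. More precisely, for every natural number $k$, no set of sound axioms each of which is at most $k$-ary is complete for the implication problem for FDs, UMIs and UMDEs (i.e. there is a finite set $\Sigma\cup\{\sigma\}$ of such atoms with $\Sigma\models\sigma$ but $\sigma$ not derivable from $\Sigma$).
   Context: A probabilistic team is a function $\mathbb{X}\colon X\to(0,1]$ with $\sum_{s\in X}\mathbb{X}(s)=1$, where $X$ is a finite set of assignments $s\colon D\to A$ of values to a finite set $D$ of variables; $|\mathbb{X}_{x=a}|=\sum_{s(x)=a}\mathbb{X}(s)$ and $X(x)=\{s(x)\mid s\in X\}$. Atoms: FDs $=\!(\bar{x},\bar{y})$ (tuples of variables, $\bar{x}$ possibly empty), satisfied iff assignments agreeing on $\bar{x}$ agree on $\bar{y}$; UMIs $x\approx y$, satisfied iff $|\mathbb{X}_{x=a}|=|\mathbb{X}_{y=a}|$ for all $a$; UMDEs $x\approx^* y$, satisfied iff the multisets $\{\{|\mathbb{X}_{x=a}|\mid a\in X(x)\}\}$ and $\{\{|\mathbb{X}_{y=a}|\mid a\in X(y)\}\}$ are equal. $\Sigma\models\sigma$ means every probabilistic team satisfying $\Sigma$ satisfies $\sigma$. An axiom is a rule schema ''from $\sigma_1,\dots,\sigma_m$ infer $\delta_1,\dots,\delta_l$''; it is $k$-ary if $m\le k$, and sound if it preserves satisfaction in every probabilistic team. An axiomatization is complete if $\Sigma\models\sigma$ implies that $\sigma$ is derivable from $\Sigma$ by its axioms. A finite axiomatization is $k$-ary for some $k$.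 *)

(* Defs.v *)
From HB Require Import structures.
From mathcomp Require Import all_boot all_order all_algebra finmap reals.

Set Implicit Arguments.
Unset Strict Implicit.
Unset Printing Implicit Defensive.

Import GRing.Theory Num.Theory.
Local Open Scope fset_scope.
Local Open Scope fmap_scope.
Local Open Scope ring_scope.

(* A countably infinite supply of variables; a team has a finite subset of
   them as its domain. *)
Notation var := nat (only parsing).

Inductive atom : Type :=
  | FD of seq var & seq var   (* =(x,y), x and y tuples *)
  | UMI of var & var          (* x ≈ y *)
  | UMDE of var & var.        (* x ≈* y *)

Definition atom_encode (phi : atom) :
    (seq var * seq var) + ((var * var) + (var * var)) :=
  match phi with
  | FD xs ys => inl (xs, ys)
  | UMI x y => inr (inl (x, y))
  | UMDE x y => inr (inr (x, y))
  end.

Definition atom_decode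
    (c : (seq var * seq var) + ((var * var) + (var * var))) : atom :=
  match c with
  | inl p => FD p.1 p.2
  | inr (inl p) => UMI p.1 p.2
  | inr (inr p) => UMDE p.1 p.2
  end.

Lemma atom_encodeK : cancel atom_encode atom_decode.
Proof. by case. Qed.

HB.instance Definition _ := Countable.copy atom (can_type atom_encodeK).

Definition atom_vars (phi : atom) : seq var :=
  match phi with
  | FD xs ys => xs ++ ys
  | UMI x y | UMDE x y => [:: x; y]
  end.

Record pteam (R : realType) := PTeam {
  team_dom : {fset var};
  team_val : choiceType;
  team_supp : {fset {fmap var -> team_val}};
  team_suppP : forall s : team_supp, domf (val s) = team_dom;
  team_wt : team_supp -> R;
  team_wtP : forall s : team_supp, 0 < team_wt s <= 1;
  team_wt_sum : \sum_(s : team_supp) team_wt s = 1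
}.

Section Semantics.
Variables (R : realType) (X : pteam R).

Definition marg (x : var) (a : team_val X) : R :=
  \sum_(s : team_supp X | (val s).[? x] == Some a) team_wt s.

Definition values (x : var) : {fset team_val X} :=
  [fset a in pmap (fun s : {fmap var -> team_val X} => s.[? x]) (team_supp X)].

(* Only meaningful when the variables of the atom are in the domain of X.
   Equality of finite multisets is perm_eq of their enumerations. *)
Definition sat (phi : atom) : Prop :=
  match phi with
  | FD xs ys => forall s t : {fmap var -> team_val X},
      s \in team_supp X -> t \in team_supp X ->
      [seq s.[? x] | x <- xs] = [seq t.[? x] | x <- xs] ->
      [seq s.[? y] | y <- ys] = [seq t.[? y] | y <- ys]
  | UMI x y => forall a : team_val X, marg x a = marg y a
  | UMDE x y => perm_eq [seq marg x a | a <- values x]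
                        [seq marg y a | a <- values y]
  end.

Definition defined_on (phi : atom) : Prop :=
  {subset atom_vars phi <= team_dom X}.

End Semantics.

Definition entails (R : realType) (Sigma : {fset atom}) (sigma : atom) : Prop :=
  forall X : pteam R,
    (forall phi, phi \in Sigma -> defined_on X phi) -> defined_on X sigma ->
    (forall phi, phi \in Sigma -> sat X phi) -> sat X sigma.

(* A rule schema "from sigma_1, ..., sigma_m infer delta_1, ..., delta_l" is
   given by m, l and the set of its instances (premises, conclusions). This
   covers schemata with metavariables for variables or for tuples, with or
   without side conditions. *)
Record schema := Schema {
  n_prem : nat;
  n_concl : nat;
  instance : n_prem.-tuple atom -> n_concl.-tuple atom -> Prop
}.

Definition at_most_ary (k : nat) (r : schema) : Prop := (n_prem r <= k)%N.

Definition sound (R : realType) (r : schema) : Prop :=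
  forall (ps : (n_prem r).-tuple atom) (cs : (n_concl r).-tuple atom),
    instance ps cs ->
    forall X : pteam R,
      (forall phi, phi \in ps -> defined_on X phi) ->
      (forall phi, phi \in cs -> defined_on X phi) ->
      (forall phi, phi \in ps -> sat X phi) ->
      forall phi, phi \in cs -> sat X phi.

Inductive derivable (Ax : schema -> Prop) (Sigma : {fset atom}) : atom -> Prop :=
  | derivable_hyp phi : phi \in Sigma -> derivable Ax Sigma phi
  | derivable_rule (r : schema) (ps : (n_prem r).-tuple atom)
      (cs : (n_concl r).-tuple atom) (phi : atom) :
      Ax r -> instance ps cs ->
      (forall psi, psi \in ps -> derivable Ax Sigma psi) ->
      phi \in cs -> derivable Ax Sigma phi.

Definition complete (R : realType) (Ax : schema -> Prop) : Prop :=
  forall (Sigma : {fset atom}) (sigma : atom),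
    entails R Sigma sigma -> derivable Ax Sigma sigma.

(* The only feature of finiteness that is required: a common bound on the
   number of premises. *)
Definition finitary (Ax : schema -> Prop) : Prop :=
  exists k : nat, forall r, Ax r -> at_most_ary k r.

(* Main.v *)
Require Import Defs.
From mathcomp Require Import all_boot all_order all_algebra finmap reals.
From mathcomp Require Import zify lra.

(** On [2 n] variables take the cycle =(2i, 2i+1), 2i+1 ≈* 2i+2 (indices
    modulo [2 n]). An FD can only decrease the number of values of a variable
    and a UMDE preserves it, so around the cycle all these numbers are equal
    and the map from values of [0] to values of [1] is bijective: the cycle
    entails =(1, 0). On the other hand, let [C] consist of the FDs implied by
    the cycle FDs alone, the trivial UMIs, and the trivial or cycle UMDEs up to
    symmetry. Fewer than [n] members of [C] miss some UMDE of the cycle, and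
    once that link is cut, four-point teams in which every variable is a
    constant or one of two independent fair coins satisfy those members and
    refute any prescribed atom outside [C]. Hence [C] is closed under sound
    rules with fewer than [n] premises, and it does not contain =(1, 0). *)

Set Implicit Arguments.
Unset Strict Implicit.
Unset Printing Implicit Defensive.

Import Order.TTheory GRing.Theory Num.Theory.
Local Open Scope fset_scope.
Local Open Scope fmap_scope.
Local Open Scope ring_scope.

(** * Counting the values of a variable *)

(** The set of pairs [(f s, g s)] is the graph of a map from the image of [f] onto that of [g]. Its
    first projection is injective, and by finiteness the second is too once the cardinals agree. *)
Lemma card_imfset_factor (T U V : choiceType) (A : {fset T})
    (f : T -> U) (g : T -> V) :
    {in A &, forall s t, f s = f t -> g s = g t} ->
  (#|` g @` A| <= #|` f @` A|)%N /\
  (#|` g @` A| = #|` f @` A| -> {in A &, forall s t, g s = g t -> f s = f t}).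
Proof.
move=> fg; set P := [fset (f s, g s) | s in A].
have P1 : fst @` P = f @` A by rewrite -imfset_comp.
have P2 : snd @` P = g @` A by rewrite -imfset_comp.
have injP1 : {in P &, injective fst}.
  move=> _ _ /imfsetP[s sA ->] /imfsetP[t tA ->] /= fst_eq.
  by rewrite fst_eq (fg s t).
have cardP1 : #|` f @` A| = #|` P| by rewrite -P1; apply/eqP/card_in_imfsetP.
rewrite cardP1 -P2; split; first exact: leq_imfset_card.
move=> /eqP/card_in_imfsetP injP2 s t sA tA gst.
have inP u : u \in A -> (f u, g u) \in P by move=> uA; apply/imfsetP; exists u.
by have [] := injP2 _ _ (inP s sA) (inP t tA) gst.
Qed.

Lemma in_values (R : realType) (X : pteam R) (x : nat) (a : team_val X) :
  reflect (exists2 s, s \in team_supp X & s.[? x] = Some a) (a \in values X x).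
Proof.
rewrite /values inE mem_pmap.
by apply: (iffP mapP) => -[s sX eq_a]; exists s.
Qed.

Lemma team_fnd (R : realType) (X : pteam R) (x : nat)
    (s : {fmap nat -> team_val X}) :
  x \in team_dom X -> s \in team_supp X -> exists a, s.[? x] = Some a.
Proof.
move=> xX sX; have := team_suppP [` sX] => /= domE.
have xs : x \in domf s by rewrite domE.
by exists (s.[xs])%fmap; rewrite in_fnd.
Qed.

(** On the domain [s.[? x]] is never [None], so counting options counts values and
    [card_imfset_factor] applies. *)
Lemma card_values (R : realType) (X : pteam R) (x : nat) :
  x \in team_dom X ->
  #|` values X x| =
  #|` (fun s : {fmap nat -> team_val X} => s.[? x]) @` team_supp X|.
Proof.
move=> xX; have <- : #|` Some @` values X x| = #|` values X x|.
  by rewrite card_imfset // => a b [].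
congr (#|` _|); apply/fsetP => o; apply/imfsetP/imfsetP => /= -[].
  by move=> a /in_values[s sX sa] ->; exists s.
move=> s sX ->; have [a sa] := team_fnd xX sX.
by rewrite sa; exists a => //; apply/in_values; exists s.
Qed.

Lemma sat_FD_card (R : realType) (X : pteam R) (x y : nat) :
    x \in team_dom X -> y \in team_dom X -> sat X (FD [:: x] [:: y]) ->
  (#|` values X y| <= #|` values X x|)%N /\
  (#|` values X y| = #|` values X x| -> sat X (FD [:: y] [:: x])).
Proof.
move=> xX yX xy.
have [s t sX tX st|le_yx eq_yx] := @card_imfset_factor _ _ _ (team_supp X)
  (fun s : {fmap nat -> team_val X} => s.[? x])
  (fun s : {fmap nat -> team_val X} => s.[? y]).
  by have := xy s t sX tX; rewrite /= st => /(_ erefl)[].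
rewrite !card_values //; split=> // /eq_yx yx s t sX tX [st].
by rewrite /= (yx s t).
Qed.

Lemma sat_UMDE_card (R : realType) (X : pteam R) (x y : nat) :
  sat X (UMDE x y) -> #|` values X x| = #|` values X y|.
Proof. by move=> /perm_size; rewrite !size_map. Qed.

(** * The cycle and its consequence *)

Definition cycle_atoms (n : nat) : {fset atom} :=
  [fset phi in [seq FD [:: i.*2] [:: i.*2.+1] | i <- iota 0 n] ++
               [seq UMDE i.*2.+1 (i.*2.+2 %% n.*2)%N | i <- iota 0 n]].

Lemma cycle_atomsP (n : nat) (phi : atom) :
  reflect (exists2 i, (i < n)%N & phi = FD [:: i.*2] [:: i.*2.+1] \/
                                  phi = UMDE i.*2.+1 (i.*2.+2 %% n.*2)%N)
          (phi \in cycle_atoms n).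
Proof.
rewrite !inE; apply: (iffP orP).
  by case=> /mapP[i]; rewrite mem_iota => lt_in ->; exists i; auto.
by case=> i lt_in [] ->; [left | right]; apply/map_f; rewrite mem_iota.
Qed.

Lemma cycle_entails (R : realType) (n : nat) :
  (0 < n)%N -> entails R (cycle_atoms n) (FD [:: 1%N] [:: 0%N]).
Proof.
move=> n_gt0 X defX _ satX.
have FDin i : (i < n)%N -> FD [:: i.*2] [:: i.*2.+1] \in cycle_atoms n.
  by move=> lt_in; apply/cycle_atomsP; exists i; auto.
have UMDEin i : (i < n)%N -> UMDE i.*2.+1 (i.*2.+2 %% n.*2)%N \in cycle_atoms n.
  by move=> lt_in; apply/cycle_atomsP; exists i; auto.
have FDdom i : (i < n)%N -> i.*2 \in team_dom X /\ i.*2.+1 \in team_dom X.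
  by move=> /FDin/defX dX; split; apply: dX; rewrite !inE eqxx ?orbT.
pose N x := #|` values X x|.
have FDle i : (i < n)%N -> (N i.*2.+1 <= N i.*2)%N.
  move=> lt_in; have [d1 d2] := FDdom i lt_in.
  exact: (sat_FD_card d1 d2 (satX _ (FDin i lt_in))).1.
have UMDEeq i : (i < n)%N -> N i.*2.+1 = N (i.*2.+2 %% n.*2)%N.
  by move=> /UMDEin/satX/sat_UMDE_card.
have dec i : (i < n)%N -> (N i.*2 <= N 0)%N /\ (N i.*2.+1 <= N 1)%N.
  elim: i => [//|i IHi] lt_in; have [|_ le1] := IHi; first lia.
  have := UMDEeq i (ltnW lt_in); rewrite modn_small; last by lia.
  have := FDle i.+1 lt_in; have : (N 1 <= N 0)%N := FDle 0%N n_gt0.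
  by rewrite doubleS; lia.
have [d0 d1] := FDdom 0%N n_gt0.
have [le10] := sat_FD_card d0 d1 (satX _ (FDin 0%N n_gt0)); apply.
apply/eqP; rewrite eqn_leq le10 /=.
(* The last link leads from [2n - 1] back to [0], which turns the bound of [dec] on [N (2n - 1)]
   into [N 0 <= N 1]. *)
have lt_n1 : (n.-1 < n)%N by lia.
have := UMDEeq n.-1 lt_n1; have [_] := dec n.-1 lt_n1.
have -> : (n.-1.*2.+2 = n.*2)%N by lia.
by rewrite modnn => le1 eq0; rewrite -[leqLHS]eq0.
Qed.

(** * Teams induced by a uniform sample space *)

Definition uniform_supp (Omega : finType) (V : choiceType)
    (f : Omega -> {fmap nat -> V}) : {fset {fmap nat -> V}} :=
  [fset f w | w in Omega].

(** Push-forward of the uniform measure: [f] may identify outcomes, as happens when a coin is copied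
    by no variable, so fibres are summed. *)
Definition uniform_wt (R : realType) (Omega : finType) (V : choiceType)
    (f : Omega -> {fmap nat -> V}) (s : uniform_supp f) : R :=
  \sum_(w | f w == val s) #|Omega|%:R^-1.

Lemma uniform_suppP (Omega : finType) (V : choiceType) (D : {fset nat})
    (f : Omega -> {fmap nat -> V}) :
  (forall w, domf (f w) = D) -> forall s : uniform_supp f, domf (val s) = D.
Proof. by move=> fD [_ /= /imfsetP[w _ ->]]. Qed.

Lemma sum_uniform_wt (R : realType) (Omega : finType) (V : choiceType)
    (f : Omega -> {fmap nat -> V}) (P : pred {fmap nat -> V}) :
  \sum_(s : uniform_supp f | P (val s)) uniform_wt R s
  = \sum_(w | P (f w)) #|Omega|%:R^-1.
Proof.
have f_in w : f w \in uniform_supp f by apply/imfsetP; exists w.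
rewrite (partition_big (fun w => [` f_in w]) (fun s => P (val s))) //=.
apply: eq_bigr => s Ps; apply: eq_bigl => w; rewrite -val_eqE /=.
by case: eqP => [->|_]; rewrite ?Ps ?andbF.
Qed.

Lemma sum_uniform (R : realType) (Omega : finType) :
  Omega -> \sum_(w : Omega) #|Omega|%:R^-1 = 1 :> R.
Proof.
move=> w0; rewrite sumr_const -[LHS]mulr_natr mulVf //.
by rewrite pnatr_eq0 -lt0n; apply/card_gt0P; exists w0.
Qed.

Lemma uniform_wtP (R : realType) (Omega : finType) (V : choiceType)
    (f : Omega -> {fmap nat -> V}) (s : uniform_supp f) :
  0 < uniform_wt R s <= 1.
Proof.
have inv_ge0 : 0 <= #|Omega|%:R^-1 :> R by rewrite invr_ge0 ler0n.
case: s => _ /= /[dup] /imfsetP[w _ ->] fw; rewrite /uniform_wt /=.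
apply/andP; split.
  rewrite (bigD1 w) //= ltr_wpDr ?sumr_ge0 // invr_gt0 ltr0n.
  by apply/card_gt0P; exists w.
rewrite -[leRHS](sum_uniform R w) [leRHS](bigID (fun w' => f w' == f w)) /=.
by rewrite lerDl sumr_ge0.
Qed.

Lemma uniform_wt_sum (R : realType) (Omega : finType) (V : choiceType)
    (f : Omega -> {fmap nat -> V}) :
  Omega -> \sum_(s : uniform_supp f) uniform_wt R s = 1.
Proof. by move=> w0; rewrite (sum_uniform_wt R f predT) sum_uniform. Qed.

Definition uniform_team (R : realType) (Omega : finType) (w0 : Omega)
    (V : choiceType) (D : {fset nat}) (f : Omega -> {fmap nat -> V})
    (fD : forall w, domf (f w) = D) : pteam R :=
  PTeam (uniform_suppP fD) (@uniform_wtP R Omega V f) (uniform_wt_sum R f w0).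

(** * Teams of constants and two independent coins *)

(* [None] marks a constant variable, [Some b] a copy of coin [b]. *)
Definition color := nat -> option bool.

Definition color_bit (c : color) (w : bool * bool) (x : nat) : bool :=
  if c x is Some b then (if b then w.1 else w.2) else false.

(* Values carry the name of their variable, so that no UMI between distinct
   variables holds, whatever the coloring. *)
Definition color_assignment (D : {fset nat}) (c : color) (w : bool * bool) :
    {fmap nat -> nat * bool} :=
  [fmap x : D => (val x, color_bit c w (val x))].

Lemma color_assignment_dom (D : {fset nat}) (c : color) (w : bool * bool) :
  domf (color_assignment D c w) = D.
Proof. by []. Qed.

Definition color_team (R : realType) (D : {fset nat}) (c : color) : pteam R :=
  uniform_team R (false, false) (color_assignment_dom D c).

Lemma color_assignmentE (D : {fset nat}) (c : color) (w : bool * bool) x :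
  x \in D -> (color_assignment D c w).[? x] = Some (x, color_bit c w x).
Proof.
move=> xD; have xd : x \in domf (color_assignment D c w) by [].
by rewrite in_fnd ffunE.
Qed.

Lemma color_suppP (R : realType) (D : {fset nat}) (c : color) s :
  reflect (exists w, s = color_assignment D c w)
          (s \in team_supp (color_team R D c)).
Proof.
by apply: (iffP (imfsetP _ _ _ _)) => [[w _ ->]|[w ->]]; exists w.
Qed.

Lemma color_marg (R : realType) (D : {fset nat}) (c : color) x
    (a : nat * bool) : x \in D ->
  @marg R (color_team R D c) x a =
  \sum_(w : bool * bool | (x, color_bit c w x) == a) 4%:R^-1.
Proof.
move=> xD; rewrite /marg.
rewrite (sum_uniform_wt R _
  (fun s : {fmap nat -> nat * bool} => s.[? x] == Some a)).
rewrite card_prod card_bool; apply: eq_bigl => w.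
by rewrite color_assignmentE.
Qed.

Lemma color_values (R : realType) (D : {fset nat}) (c : color) x
    (a : nat * bool) : x \in D ->
  (a \in values (color_team R D c) x) =
  (a.1 == x) && ((c x == None) ==> ~~ a.2).
Proof.
move=> xD; apply/in_values/andP => [[s /color_suppP[w ->]]|].
  rewrite color_assignmentE // => -[<-]; rewrite /= eqxx /color_bit.
  by case: (c x).
case: a => _ b [/= /eqP -> /implyP xb].
(* With both coins showing [b], it does not matter which one [x] copies. *)
exists (color_assignment D c (b, b)).
  by apply/(color_suppP R); exists (b, b).
rewrite color_assignmentE // /color_bit; case: (c x) xb => [[]//|/(_ isT)].
by case: b.
Qed.

Lemma color_margs (R : realType) (D : {fset nat}) (c : color) x : x \in D ->
  [seq @marg R (color_team R D c) x a | a <- values (color_team R D c) x] =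
  if c x == None then [:: 1] else [:: 2^-1; 2^-1].
Proof.
move=> xD; set vs := values _ x.
have vsE : perm_eq vs (if c x == None then [:: (x, false)]
                       else [:: (x, true); (x, false)]).
  apply: uniq_perm; first exact: fset_uniq.
    by case: ifP => _ //=; rewrite inE xpair_eqE andbF.
  case=> y b; rewrite color_values //=; case: ifP => _.
    by rewrite inE xpair_eqE; case: b.
  by rewrite !inE !xpair_eqE andbT; case: b; rewrite ?andbT ?andbF ?orbF.
have vsP a : a \in vs -> marg (X := color_team R D c) x a =
    if c x == None then 1 else 2^-1.
  rewrite color_values // => /andP[/eqP xa cx]; rewrite color_marg //.
  rewrite big_mkcond -(pair_bigA _ (fun p q =>
    if (x, color_bit c (p, q) x) == a then 4%:R^-1 else 0)) /=.
  rewrite !big_bool /= /color_bit; case: a xa cx => _ b /= ->.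
  rewrite !xpair_eqE !eqxx /=.
  by case: (c x) => [[]|]; case: b => //= _; lra.
have -> : [seq marg (X := color_team R D c) x a | a <- vs] =
    nseq (size vs) (if c x == None then 1 else 2^-1).
  rewrite -(size_map (marg (X := color_team R D c) x)); apply/all_pred1P.
  by apply/allP => _ /mapP[a /vsP av ->] /=; rewrite av.
by rewrite (perm_size vsE); case: ifP.
Qed.

Definition color_sat (c : color) (phi : atom) : bool :=
  match phi with
  | FD xs ys => all (fun y => (c y == None) || (c y \in map c xs)) ys
  | UMI x y => x == y
  | UMDE x y => (c x == None) == (c y == None)
  end.

(** By independence, a coin variable is a function of [xs] only if some member of [xs] copies the
    same coin. The marginals of a variable form the multiset of a constant or that of a fair coin,
    and a UMDE only compares these two types. *)
Lemma color_teamP (R : realType) (D : {fset nat}) (c : color) (phi : atom) :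
  {subset atom_vars phi <= D} ->
  sat (color_team R D c) phi <-> color_sat c phi.
Proof.
case: phi => [xs ys|x y|x y] phiD /=.
- have xsD x : x \in xs -> x \in D 
    by move=> x_xs; apply: phiD; rewrite mem_cat x_xs.
  have ysD y : y \in ys -> y \in D 
    by move=> y_ys; apply: phiD; rewrite mem_cat y_ys orbT.
  split=> [satc|/allP c_ys].
    apply/allP => y y_ys; case cy: (c y) => [b|] //=.
    apply: contraT => /mapP xsNy.
    have in_supp w : color_assignment D c w \in team_supp (color_team R D c).
      by apply/(color_suppP R); exists w.
    (* These two outcomes differ in coin [b] only, which no member of [xs] copies. *)
    have /satc : [seq (color_assignment D c (false, false)).[? x] | x <- xs] =
                 [seq (color_assignment D c (b, ~~ b)).[? x] | x <- xs].
      apply/eq_in_map => x x_xs; rewrite !color_assignmentE ?xsD // /color_bit.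
      case cx: (c x) => [b'|] //; have [b'b|] := eqVneq b' b.
        by case: xsNy; exists x; rewrite // cx b'b.
      by case: b b' {cx cy xsNy} => [] [].
    move=> /(_ (in_supp _) (in_supp _))/eq_in_map/(_ y y_ys).
    rewrite !color_assignmentE ?ysD // /color_bit cy => -[].
    by case: b {cy xsNy}.
  move=> _ _ /(color_suppP R)[w ->] /(color_suppP R)[w' ->] /eq_in_map eq_xs.
  apply/eq_in_map => y y_ys; rewrite !color_assignmentE ?ysD //.
  congr (Some (_, _)); have := c_ys y y_ys; rewrite /color_bit.
  case cy: (c y) => [b|] //= /mapP[x x_xs cx].
  have := eq_xs x x_xs; rewrite !color_assignmentE ?xsD //.
  by rewrite /color_bit -cx => -[].
- have [xD yD] : x \in D /\ y \in D.
    by split; apply: phiD; rewrite !inE eqxx ?orbT.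
  split=> [satc|/eqP -> //]; apply: contraT => neq_xy.
  (* This value has positive weight at [x], but its tag excludes it at [y]. *)
  have /eqP := satc (x, color_bit c (false, false) x).
  rewrite !color_marg // (bigD1 (false, false)) //=.
  rewrite [X in _ == X]big_pred0; last first.
    by move=> w; rewrite xpair_eqE eq_sym (negPf neq_xy).
  rewrite gt_eqF // ltr_wpDr ?sumr_ge0 //; last by rewrite invr_gt0.
  by move=> w _; rewrite invr_ge0.
- have [xD yD] : x \in D /\ y \in D.
    by split; apply: phiD; rewrite !inE eqxx ?orbT.
  rewrite !color_margs //.
  case: (c x == None) (c y == None) => [] []; split=> //.
  all: first [by move/perm_size | by rewrite perm_refl].
Qed.

(** * The closed class of atoms and the colorings that cut the cycle *)

Definition cycle_link (n x y : nat) : bool :=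
  [&& odd x, x < n.*2 & y == x.+1 %% n.*2]%N.

(** The class [C]. Cycle FDs lead from even to odd variables and so never chain: one step yields the
    closure of [xs]. *)
Definition cycle_closed (n : nat) (phi : atom) : bool :=
  match phi with
  | FD xs ys =>
      all (fun y => (y \in xs) || [&& odd y, (y < n.*2)%N & y.-1 \in xs]) ys
  | UMI x y => x == y
  | UMDE x y => [|| x == y, cycle_link n x y | cycle_link n y x]
  end.

(* The value on atoms other than links is junk; it is harmless, since indices
   only serve to find a link that a short list of atoms does not contain. *)
Definition link_index (phi : atom) : nat :=
  if phi is UMDE x y then (if odd x then x else y)./2 else 0%N.

Definition cut_color (n j : nat) (c : color) : Prop :=
  (forall v, odd v -> v < n.*2 -> c v = None \/ c v = c v.-1)%N /\
  (forall x, odd x -> x < n.*2 -> x./2 != j ->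
     (c x == None) = (c (x.+1 %% n.*2)%N == None))%N.

Lemma cut_color_sat (n j : nat) (c : color) (phi : atom) :
  cut_color n j c -> cycle_closed n phi -> link_index phi != j ->
  color_sat c phi.
Proof.
case=> cFD cUMDE; case: phi => [xs ys|x y|x y] //=.
  move=> /allP ys_cl _; apply/allP => y /ys_cl /orP[y_xs|].
    by apply/orP; right; apply: map_f.
  case/and3P => y_odd y_lt y_xs; have [->//|->] := cFD y y_odd y_lt.
  by apply/orP; right; apply: map_f.
(* A link ends in an even variable, so parity tells its two ends apart and [link_index] recovers its
   source in either orientation. *)
have linkP u v : cycle_link n u v -> [/\ odd u, ~~ odd v & u./2 != j ->
    (c u == None) == (c v == None)].
  case/and3P=> u_odd u_lt /eqP ->; split=> //.
    by rewrite odd_mod ?odd_double //= negbK.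
  by move=> uj; rewrite (cUMDE u).
case/or3P => [/eqP -> //|/linkP[-> _]//|/linkP[y_odd x_even yj]].
by rewrite (negPf x_even) => /yj; rewrite eq_sym.
Qed.

(* Position of [v] on the path obtained by cutting the cycle after
   variable [2 j + 1]. *)
Definition cut_pos (n j v : nat) : nat :=
  (if v < j.+1.*2 then v + n.*2 - j.+1.*2 else v - j.+1.*2)%N.

(** Positions have the parity of their variables. Links other than the cut one join an odd position
    to the next, so an even threshold never separates their ends. It separates only positions [t]
    and [t + 1], joined by an FD whose target is then constant. *)
Lemma cut_color_threshold (n j t : nat) (c : color) :
    (j < n)%N -> ~~ odd t ->
    (forall v, (v < n.*2)%N -> (c v == None) = (t < cut_pos n j v)%N) ->
    (forall v, odd v -> (v < n.*2)%N -> (cut_pos n j v < t)%N ->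
       c v = c v.-1) ->
  cut_color n j c.
Proof.
move=> lt_jn t_even cN cE; split=> v v_odd lt_vn.
  case: (ltnP t (cut_pos n j v)) => [lt_tv|le_vt].
    by left; apply/eqP; rewrite cN.
  right; apply: cE => //; rewrite ltn_neqAle le_vt andbT.
  by apply: contraNneq t_even => <-; rewrite /cut_pos; do ?[case: ifP]; lia.
have lt_mod : (v.+1 %% n.*2 < n.*2)%N by rewrite ltn_mod; lia.
move=> v_j; rewrite (cN v lt_vn) (cN _ lt_mod).
case: (ltnP v.+1 n.*2) => [lt_v1|le_v1].
  by rewrite modn_small // /cut_pos; do ?[case: ifP]; lia.
have -> : v.+1 = n.*2 by lia.
by rewrite modnn /cut_pos doubleS /=; case: ifP; lia.
Qed.

Lemma cut_color_refutes (n j : nat) (phi : atom) :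
    (j < n)%N -> ~~ cycle_closed n phi ->
  exists2 c, cut_color n j c & ~~ color_sat c phi.
Proof.
move=> lt_jn; case: phi => [xs ys|x y|x y] /=.
- case/allPn => y y_ys; rewrite negb_or => /andP[y_xs y_cl].
  have refutes c :
      c y = Some true -> (forall x, x \in xs -> c x != Some true) ->
      ~~ all (fun y => (c y == None) || (c y \in map c xs)) ys.
    move=> cy cxs; apply/allPn; exists y => //; rewrite cy /=.
    by apply/mapP => -[x /cxs /eqP cx /esym].
  case: (ltnP y n.*2) => [lt_yn|le_ny]; last first.
    (* In the FD cases coin [true] is kept for [y] and whatever must share its color, while [xs]
       avoids that coin. *)
    exists (fun v => Some (v == y)).
      split=> // v _ lt_vn; right.
      by rewrite !ltn_eqF //; lia.
    apply: refutes; rewrite ?eqxx // => x x_xs.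
    by apply: contraNneq y_xs => -[/eqP <-].
  move: y_cl; rewrite lt_yn /=; case y_odd: (odd y) => /= y_cl.
    exists (fun v => Some ((v == y) || (v == y.-1))).
      by split=> // v v_odd lt_vn; right; congr Some; lia.
    apply: refutes; rewrite ?eqxx // => x x_xs.
    apply/eqP => -[] /orP[] /eqP xE.
      by rewrite -xE x_xs in y_xs.
    by rewrite -xE x_xs in y_cl.
  (* Here [y] is even, and [y.+1] may occur in [xs], so it cannot copy [y] and is made constant. The
     links then force constants from there up to the cut. *)
  pose t := cut_pos n j y.
  exists (fun v => if (v < n.*2) && (t < cut_pos n j v) then None
                   else Some (v == y))%N.
    apply: (@cut_color_threshold n j t) => //.
    + by rewrite /t /cut_pos; do ?[case: ifP]; lia.
    + by move=> v ->; case: ifP.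
    + move=> v v_odd lt_vn lt_vt; rewrite lt_vn ltnNge ltnW //=.
      have [-> ->] : (v.-1 < n.*2)%N = true /\ (t < cut_pos n j v.-1)%N = false.
        move: lt_vt; rewrite /t /cut_pos.
        by do ?[case: ifP]; split; lia.
      congr Some; rewrite [LHS](_ : _ = false); last first.
        by apply/eqP => vy; rewrite vy y_odd in v_odd.
      apply/esym/eqP => vy; move: lt_vt; rewrite /t -vy /cut_pos.
      by do ?[case: ifP]; lia.
  apply: refutes; first by rewrite ltnn andbF eqxx.
  move=> x x_xs; case: ifP => // _.
  by apply: contraNneq y_xs => -[/eqP <-].
- by exists (fun _ => None) => //; split=> // v _ _; left.
- rewrite !negb_or => /and3P[neq_xy nxy nyx].
  (* By symmetry [x] is either off the cycle or before [y] on the cut path. *)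
  wlog: x y neq_xy nxy nyx / ((n.*2 <= x) || [&& x < n.*2, y < n.*2 &
      cut_pos n j x < cut_pos n j y])%N.
    move=> WL; case: (boolP ((n.*2 <= x) || [&& x < n.*2, y < n.*2 &
      cut_pos n j x < cut_pos n j y])%N) => [/WL|H]; first exact.
    have [||||c cc cxy] := WL y x; rewrite // 1?eq_sym //.
      by move: H neq_xy; rewrite /cut_pos; do ?[case: ifP]; lia.
    by exists c; rewrite // eq_sym.
  case/orP => [le_nx|/and3P[lt_xn lt_yn lt_xy]].
    exists (fun v => if v == x then Some true else None).
      split=> v v_odd lt_vn; first by left; case: eqP => // vx; lia.
      move=> _; rewrite !ifN //; last by apply/eqP; lia.
      by have := ltn_pmod v.+1 (leq_ltn_trans (leq0n v) lt_vn); lia.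
    by rewrite /= eqxx eq_sym ifN // eq_sym.
  (* The least even position not before [x]. It equals the position of [x] or, for odd [x], the next
     one, which is the end of the link from [x] and hence not [y]. So [x] is a coin and [y] a
     constant. *)
  pose t := (cut_pos n j x).+1./2.*2.
  exists (fun v => if (v < n.*2) && (t < cut_pos n j v) then None
                   else Some true)%N.
    apply: (@cut_color_threshold n j t) => //.
    + by rewrite /t odd_double.
    + by move=> v ->; case: ifP.
    + move=> v v_odd lt_vn lt_vt; rewrite lt_vn ltnNge ltnW //=.
      rewrite ifN // negb_and -leqNgt; apply/orP; right.
      by move: lt_vt; rewrite /t /cut_pos; do ?[case: ifP]; lia.
  rewrite /= lt_xn lt_yn /= (_ : (t < cut_pos n j x)%N = false); last by lia.
  rewrite (_ : (t < cut_pos n j y)%N) //.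
  case x_odd: (odd x); last first.
    by move: lt_xy; rewrite /t /cut_pos; do ?[case: ifP]; lia.
  have : y != (x.+1 %% n.*2)%N by move: nxy; rewrite /cycle_link x_odd lt_xn.
  case: (ltnP x.+1 n.*2) => [lt_x1|le_x1].
    rewrite modn_small //.
    by move: lt_xy; rewrite /t /cut_pos; do ?[case: ifP]; lia.
  have -> : x.+1 = n.*2 by lia.
  by rewrite modnn; move: lt_xy; rewrite /t /cut_pos; do ?[case: ifP]; lia.
Qed.

(** * Closure under sound rules of bounded arity *)

Lemma missing_index (T : Type) (f : T -> nat) (s : seq T) (n : nat) :
  (size s < n)%N -> exists2 j, (j < n)%N & j \notin map f s.
Proof.
move=> lt_sn; have : ~~ all (fun j => j \in map f s) (iota 0 n).
  apply: contraL lt_sn => /allP sub_s; rewrite -leqNgt -(size_iota 0 n).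
  by rewrite -(size_map f); apply: uniq_leq_size; rewrite ?iota_uniq.
by case/allPn => j; rewrite mem_iota => lt_jn j_s; exists j.
Qed.

Lemma derivable_cycle_closed (R : realType) (n : nat) (Ax : schema -> Prop)
    (phi : atom) :
    (forall r, Ax r -> sound R r) -> (forall r, Ax r -> (n_prem r < n)%N) ->
  derivable Ax (cycle_atoms n) phi -> cycle_closed n phi.
Proof.
move=> Ax_sound Ax_ary; elim=> {phi} [phi|r ps cs phi Ax_r r_inst _ IH phi_cs].
  case/cycle_atomsP => i lt_in [] -> /=.
    by rewrite !inE eqxx /= odd_double /= andbT; lia.
  by rewrite /cycle_link /= odd_double eqxx; lia.
have [|j lt_jn j_ps] := @missing_index _ link_index ps n.
  by rewrite size_tuple Ax_ary.
apply: contraT => /(cut_color_refutes lt_jn)[c c_cut c_phi].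
(* Soundness speaks only of teams on which the premises and all conclusions of the rule are defined,
   not just [phi]. *)
pose D := [fset x in flatten [seq atom_vars psi | psi <- ps ++ cs]].
have inD psi : psi \in ps ++ cs -> {subset atom_vars psi <= D}.
  by move=> psi_in x x_psi; rewrite inE; apply/flatten_mapP; exists psi.
have psD psi : psi \in (ps : seq atom) -> {subset atom_vars psi <= D}.
  by move=> psi_ps; apply: inD; rewrite mem_cat psi_ps.
have csD psi : psi \in (cs : seq atom) -> {subset atom_vars psi <= D}.
  by move=> psi_cs; apply: inD; rewrite mem_cat psi_cs orbT.
case/negP: c_phi; apply/(color_teamP R c (csD phi phi_cs)).
apply: (Ax_sound r Ax_r ps cs r_inst) => // psi psi_ps.
apply/(color_teamP R c (psD psi psi_ps)).
apply: (cut_color_sat c_cut (IH psi psi_ps)).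
by apply: contraNneq j_ps => <-; apply: map_f.
Qed.

Theorem theorem3p16 (R : realType) :
  (~ exists Ax : schema -> Prop,
       [/\ forall r, Ax r -> sound R r, finitary Ax & complete R Ax])
  /\
  (forall (k : nat) (Ax : schema -> Prop),
     (forall r, Ax r -> sound R r) ->
     (forall r, Ax r -> at_most_ary k r) ->
     exists (Sigma : {fset atom}) (sigma : atom),
       entails R Sigma sigma /\ ~ derivable Ax Sigma sigma).
Proof.
have incomplete (k : nat) (Ax : schema -> Prop) :
    (forall r, Ax r -> sound R r) -> (forall r, Ax r -> at_most_ary k r) ->
  exists (Sigma : {fset atom}) (sigma : atom),
    entails R Sigma sigma /\ ~ derivable Ax Sigma sigma.
  move=> Ax_sound Ax_ary.
  (* With [k.+1] links, any [k] premises miss one. *)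
  exists (cycle_atoms k.+1), (FD [:: 1%N] [:: 0%N]).
  split; first exact: cycle_entails.
  by move/(derivable_cycle_closed Ax_sound (n := k.+1) Ax_ary).
split=> // -[Ax [Ax_sound [k Ax_ary] Ax_complete]].
have [Sigma [sigma [ent]]] := incomplete k Ax Ax_sound Ax_ary.
by case; apply: Ax_complete.
Qed.
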